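(* Let $T=(T_1,\dots,T_n)$ be a weighted shift on $\mathcal{H}_n$ with weights $\Lambda=\{\lambda_{i,w}\}$ and weight function $W$. The eigenvalues for $\mathfrak{L}_\Lambda^*$ consist of all $\lambda\in\mathbb{C}^n$ for which $$\sum_{w\in\mathbb{F}_n^+}|w(\lambda)|^2\,W(e,w)^{-2}<\infty .$$
   Context: Let $n\ge 2$ and let $\mathbb{F}_n^+$ be the unital free semigroup on $n$ noncommuting letters $\{1,\dots,n\}$, with unit $e$ (the empty word). Fock space is $\mathcal{H}_n=\ell^2(\mathbb{F}_n^+)$ with orthonormal basis $\{\xi_w: w\in\mathbb{F}_n^+\}$. A weighted shift on $\mathcal{H}_n$ with weights $\Lambda=\{\lambda_{i,w}: 1\le i\le n,\ w\in\mathbb{F}_n^+\}$ is an $n$-tuple $T=(T_1,\dots,T_n)$ of bounded operators on $\mathcal{H}_n$ with $T_i\xi_w=\lambda_{i,w}\xi_{iw}$ for all $i,w$; throughout, all $\lambda_{i,w}>0$ (and $\sup_{i,w}\lambda_{i,w}<\infty$ by boundedness). $\mathfrak{L}_\Lambda$ denotes the unital weak-operator-topology (WOT) closed algebra generated by $\{T_1,\dots,T_n\}$. The weight function $W:\mathbb{F}_n^+\times\mathbb{F}_n^+\to\mathbb{R}_+$ is $W(u,e)=1$ and $W(u,w)=\lambda_{i_1,u}\lambda_{i_2,i_1u}\cdots\lambda_{i_k,i_{k-1}\cdots i_1u}$ for $w=i_k\cdots i_1$. A point $(\lambda_1,\dots,\lambda_n)\in\mathbb{C}^n$ is an eigenvalue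 for $\mathfrak{L}_\Lambda^*$ if there is a nonzero $\xi\in\mathcal{H}_n$ with $T_i^*\xi=\lambda_i\xi$ for $1\le i\le n$. For $\lambda=(\lambda_1,\dots,\lambda_n)\in\mathbb{C}^n$ and a word $w=i_1\cdots i_k$, $w(\lambda)=\lambda_{i_1}\cdots\lambda_{i_k}$, and $e(\lambda)=1$. *)

(* Defs.v *)
From HB Require Import structures.
From mathcomp Require Import all_boot all_order all_algebra.
From mathcomp Require Import all_classical all_reals all_analysis.
From mathcomp Require Import complex ring.
From mathcomp.analysis.showcase Require Import summability.
Set Implicit Arguments.
Unset Strict Implicit.
Unset Printing Implicit Defensive.
Import Order.TTheory GRing.Theory Num.Theory numFieldNormedType.Exports.
Import Normc.
Local Open Scope classical_set_scope.
Local Open Scope complex_scope.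
Local Open Scope ring_scope.

Section Ell2.
Context {R : realType} {I : choiceType}.
Implicit Types (f g : I -> R[i]^o).

Definition sqnorm_sum f : \bar R :=
  \esum_(w in [set: I]) ((normc (f w)) ^+ 2)%:E.

Definition square_summable : {pred I -> R[i]^o} :=
  fun f => `[< (sqnorm_sum f < +oo)%E >].

Lemma normc_sq_ge0 (z : R[i]) : (0 <= ((normc z) ^+ 2)%:E)%E.
Proof. by rewrite lee_fin sqr_ge0. Qed.

Lemma normc_ge0 (z : R[i]) : 0 <= normc z.
Proof. by case: z => a b; rewrite /normc sqrtr_ge0. Qed.

Lemma square_summable_submod : submod_closed square_summable.
Proof.
split.
  apply/asboolP; rewrite /sqnorm_sum esum1 ?ltry// => w _.
  by rewrite [X in normc X](_ : _ = 0%C)// normc0 expr0n.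
move=> a f g /asboolP sf /asboolP sg; apply/asboolP.
pose h (w : I) : \bar R := (2 * normc (f w) ^+ 2 * normc a ^+ 2)%:E.
pose k (w : I) : \bar R := (2 * normc (g w) ^+ 2)%:E.
have esumZ (c : R) u : 0 <= c -> (sqnorm_sum u < +oo)%E ->
    (\esum_(w in [set: I]) (c * normc (u w) ^+ 2)%:E < +oo)%E.
  move=> c0 su; have su_fin : sqnorm_sum u \is a fin_num.
    by rewrite ge0_fin_numE// esum_ge0// => w _; exact: normc_sq_ge0.
  apply: (@le_lt_trans _ _ (c%:E * sqnorm_sum u)%E); last first.
    by rewrite -(fineK su_fin) -EFinM ltry.
  apply: ub_ereal_sup => _ [A [finA _] <-].
  rewrite fsbig_finite//=.
  under eq_bigr do rewrite EFinM.
  rewrite -ge0_sume_distrr//; last by move=> w _; exact: normc_sq_ge0.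
  rewrite lee_wpmul2l ?lee_fin// -fsbig_finite//.
  by apply: ereal_sup_ubound; exists A.
apply: (@le_lt_trans _ _ (\esum_(w in [set: I]) (h w + k w)%E)).
  apply: le_esum => w _; rewrite /h /k -EFinD lee_fin.
  have le1 : normc ((a *: f + g) w) <= normc a * normc (f w) + normc (g w).
    by rewrite -normcM; exact: le_normcD.
  apply: (@le_trans _ _ ((normc a * normc (f w) + normc (g w)) ^+ 2)).
    by rewrite lerXn2r// nnegrE ?addr_ge0 ?mulr_ge0 ?normc_ge0.
  rewrite -subr_ge0 (_ : _ - _ = (normc a * normc (f w) - normc (g w)) ^+ 2).
    exact: sqr_ge0.
  by rewrite sqrrD sqrrB exprMn !mulrA; ring.
rewrite esumD//; last 2 first.
- by move=> w _; rewrite lee_fin; do !apply: mulr_ge0 => //; rewrite ?normc_ge0.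
- by move=> w _; rewrite lee_fin; do !apply: mulr_ge0 => //; rewrite ?normc_ge0.
rewrite lte_add_pinfty//; last exact: esumZ.
rewrite /h (eq_esum (b := fun w => (2 * normc a ^+ 2 * normc (f w) ^+ 2)%:E)).
  by apply: esumZ => //; rewrite mulr_ge0 ?sqr_ge0.
by move=> w _; rewrite mulrAC.
Qed.

End Ell2.

HB.instance Definition _ (R : realType) (I : choiceType) :=
  GRing.isSubmodClosed.Build R[i] (I -> R[i]^o) square_summable
    square_summable_submod.

Record ell2 (R : realType) (I : choiceType) := Ell2 {
  ell2_fun :> I -> R[i]^o;
  ell2P : ell2_fun \in square_summable }.

HB.instance Definition _ (R : realType) (I : choiceType) :=
  [isSub for @ell2_fun R I].
HB.instance Definition _ (R : realType) (I : choiceType) :=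
  [Choice of ell2 R I by <:].
HB.instance Definition _ (R : realType) (I : choiceType) :=
  [SubChoice_isSubLmodule of ell2 R I by <:].

Section Operators.
Context {R : realType} {I : choiceType}.
Notation H := (ell2 R I).

Lemma square_summable_delta (u : I) :
  (fun w => (w == u)%:R : R[i]^o) \in square_summable.
Proof.
apply/asboolP; rewrite /sqnorm_sum.
rewrite (eq_esum (b := fun w => if w \in [set u] then 1%E else 0%E)); last first.
  move=> w _; case: (eqVneq w u) => [->|wu].
    by rewrite ifT ?inE// [X in normc X](_ : _ = 1%C)// normc1 expr1n.
  rewrite ifF; last by apply/negbTE; rewrite notin_setE => /= /eqP; apply/negP.
  by rewrite [X in normc X](_ : _ = 0%C)// normc0 expr0n.
by rewrite -esum_mkcond esum_set1 ?ltry// lee_fin.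
Qed.

Definition xi (u : I) : H := Ell2 (square_summable_delta u).

Definition ell2_norm (x : H) : R := Num.sqrt (fine (sqnorm_sum x)).

(* Linear in the first argument; the sum is the unconditional one, i.e. the
   limit of the partial sums along the directed set of finite subsets of [I]. *)
Definition ell2_inner (x y : H) : R[i]^o :=
  summability.sum (fun w => x w * (y w)^* : R[i]^o).

Definition bounded_operator (T : H -> H) : Prop :=
  exists M : R, forall x : H, ell2_norm (T x) <= M * ell2_norm x.

(* The adjoint of a bounded operator, i.e. the unique operator such that
   <T x, y> = <x, adjoint T y> for all x and y. *)
Definition adjoint (T : H -> H) (y : H) : H :=
  xget 0 [set z : H | forall x : H, ell2_inner (T x) y = ell2_inner x z].

End Operators.

Section WeightedShift.
Context {R : realType} {n : nat}.
Notation word := (seq 'I_n).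
Notation fock := (ell2 R word).

Definition weighted_shift (Lambda : 'I_n -> word -> R)
    (T : 'I_n -> {linear fock -> fock}) : Prop :=
  (forall i, bounded_operator (T i)) /\
  (forall i w, T i (xi w) = (Lambda i w)%:C *: xi (i :: w)).

(* The word i_k ... i_1 is the list [:: i_k; ...; i_1]. *)
Fixpoint weight (Lambda : 'I_n -> word -> R) (u w : word) : R :=
  if w is i :: w' then weight Lambda u w' * Lambda i (w' ++ u) else 1.

Definition word_eval (lam : 'rV[R[i]]_n) (w : word) : R[i] :=
  \prod_(i <- w) lam ord0 i.

Definition adjoint_eigenvalue (T : 'I_n -> {linear fock -> fock})
    (lam : 'rV[R[i]]_n) : Prop :=
  exists2 x : fock, x != 0 & forall i, adjoint (T i) x = lam ord0 i *: x.

End WeightedShift.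

(* Main.v *)
(* The coordinates of [T_i x] are forced by density of the finitely supported
   vectors: [(T_i x)(iw) = Lambda_{i,w} x(w)], and [(T_i x)(v) = 0] if [v] does
   not start with [i]. Reindexing the inner product along [w |-> iw] then gives
   [(T_i^* x)(w) = Lambda_{i,w} x(iw)]. Hence [T_i^* x = lam_i x] for all [i]
   says [x(iw) = lam_i x(w) / Lambda_{i,w}], that is,
   [x(w) = w(lam) W(e,w)^-1 x(e)], and such a nonzero [x] exists in l^2 exactly
   when the series converges. *)
Require Import Defs.
From mathcomp Require Import all_boot all_order all_algebra finmap.
From mathcomp Require Import all_classical all_reals all_analysis.
From mathcomp Require Import complex ring.
From mathcomp.analysis.showcase Require Import summability.
Set Implicit Arguments.
Unset Strict Implicit.
Unset Printing Implicit Defensive.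
Import Order.TTheory GRing.Theory Num.Theory numFieldNormedType.Exports.
Import Normc.
Local Open Scope classical_set_scope.
Local Open Scope complex_scope.
Local Open Scope ring_scope.

(** * Unconditional sums: reindexing and singly supported families *)

Section UnconditionalSum.
Context {K : numFieldType} {V : normedModType K}.

Lemma partial_sumE (I : choiceType) (f : I -> V) (A : {fset I}) :
  partial_sum f A = \sum_(w <- A) f w.
Proof. by rewrite big_seq_fsetE. Qed.

(* No summability is needed: the two nets of partial sums generate the same
   filter on [V], hence have the same (possibly junk) limit. *)
Lemma sum_reindex (I J : choiceType) (h : I -> J) (f : J -> V) :
  injective h -> (forall v, ~ range h v -> f v = 0) ->
  summability.sum f = summability.sum (f \o h).
Proof.
move=> h_inj f0; rewrite /summability.sum; congr (lim _).
(* Here [A] is h(B) together with indices outside the range of [h], where [f] vanishes. *)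
have sum_image (A : {fset J}) (B : {fset I}) : (h @` B `<=` A)%fset ->
    (forall w, h w \in A -> w \in B) -> partial_sum f A = partial_sum (f \o h) B.
  move=> BA AB; rewrite !partial_sumE -(big_fset_incl _ BA).
    by rewrite big_imfset//= => u v _ _; exact: h_inj.
  move=> v vA vB; apply: f0 => -[w _ wv]; move: vB; rewrite -wv in_imfset//=.
  by apply: AB; rewrite wv.
pose pre (A : {fset J}) := fset_set (h @^-1` [set` A]).
have preE A w : (w \in pre A) = (h w \in A).
  rewrite in_fset_set; last first.
    by apply: finite_preimage => // u v _ _; exact: h_inj.
  by apply/idP/idP; rewrite inE.
apply/seteqP; split=> P [A0 _ A0P].
(* If [B] contains [pre A0], its partial sum is that of the union of h(B) and [A0], a set beyond
   [A0]. *)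
- exists (pre A0) => // B /= /fsubsetP preB.
  rewrite -(sum_image (h @` B `|` A0)%fset).
  + by apply: A0P; exact: fsubsetUr.
  + exact: fsubsetUl.
  + move=> w; rewrite in_fsetU => /orP[/imfsetP[u /= uB /h_inj ->]//|wA].
    by apply: preB; rewrite preE.
(* Conversely, if [A] contains h([A0]), its partial sum is that of [pre A], which contains [A0]. *)
- exists (h @` A0)%fset => // A /= /fsubsetP imA.
  rewrite /preimage /= (sum_image A (pre A)).
  + apply: A0P => /=; apply/fsubsetP => w wA; rewrite preE.
    by apply: imA; rewrite in_imfset.
  + by apply/fsubsetP => _ /imfsetP[w /= wA ->]; rewrite -preE.
  + by move=> w; rewrite preE.
Qed.

(** The net of partial sums is constant from the finite set {u} on. *)
Lemma sum_single (I : choiceType) (f : I -> V) (u : I) :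
  (forall w, w != u -> f w = 0) -> summability.sum f = f u.
Proof.
move=> f0; apply: (@cvg_lim V (@norm_hausdorff _ V) _ _ totally_filter).
apply: (@cvg_near_cst _ _ _ _ _ totally_filter); exists [fset u]%fset => // A /=.
rewrite fsub1set => uA; rewrite partial_sumE (big_fsetD1 u)//= big1_seq ?addr0//.
by move=> w /andP[_]; rewrite !inE => /andP[/f0].
Qed.
End UnconditionalSum.

Lemma ell2_sumE (R : realType) (I : choiceType) (J : Type) (s : seq J)
    (F : J -> ell2 R I) (w : I) :
  (\sum_(j <- s) F j) w = \sum_(j <- s) F j w.
Proof. by elim/big_rec2: _ => //= j z t _ <-. Qed.

(** * The norm and the density of finitely supported vectors *)

Section Ell2Norm.
Context {R : realType} {I : choiceType}.
Notation H := (ell2 R I).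
Implicit Types (x y : H).

Lemma sqnorm_sum_fin_num x : sqnorm_sum x \is a fin_num.
Proof.
rewrite ge0_fin_numE; first by have /asboolP := ell2P x.
by apply: esum_ge0 => w _; exact: normc_sq_ge0.
Qed.

Lemma ell2_norm_le x (e : R) : 0 <= e ->
  (ell2_norm x <= e) = (sqnorm_sum x <= (e ^+ 2)%:E)%E.
Proof.
move=> e0; rewrite -[in RHS](fineK (sqnorm_sum_fin_num x)) lee_fin.
by rewrite /ell2_norm -{1}(ger0_norm e0) -sqrtr_sqr ler_sqrt// sqr_ge0.
Qed.

Lemma normc_le_ell2_norm x (w : I) : normc (x w) <= ell2_norm x.
Proof.
have : (((normc (x w)) ^+ 2)%:E <= sqnorm_sum x)%E.
  by apply: esum_ge; exists [set w] => //; rewrite fsbig_set1.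
rewrite -(fineK (sqnorm_sum_fin_num x)) lee_fin => le_sq.
by rewrite -[leLHS]ger0_norm ?normc_ge0// -sqrtr_sqr ler_wsqrtr.
Qed.

Lemma ell2_norm_xi (u : I) : ell2_norm (xi u : H) <= 1.
Proof.
rewrite ell2_norm_le// expr1n /sqnorm_sum (esumID [set u]); last first.
  by move=> w _; exact: normc_sq_ge0.
rewrite setTI esum_set1 ?normc_sq_ge0//= eqxx [X in (_ + X)%E]esum1 ?adde0.
  by rewrite [X in normc X](_ : _ = 1%C)// normc1 expr1n.
move=> w [_ /= /eqP/negbTE ->].
by rewrite [X in normc X](_ : _ = 0%C)// normc0 expr0n.
Qed.

(** A finite set whose partial sum comes within [e ^+ 2] of the supremum [sqnorm_sum x] leaves a
    tail of squared norm at most [e ^+ 2]. *)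
Lemma ell2_norm_tail x (e : R) : 0 < e ->
  exists A : {fset I}, ell2_norm (x - \sum_(w <- A) x w *: xi w) <= e.
Proof.
move=> e0; have e20 : 0 < e ^+ 2 by rewrite exprn_gt0.
have [_ [A [finA _] <-]] := ub_ereal_sup_adherent e20 (sqnorm_sum_fin_num x).
rewrite -/(sqnorm_sum x) => ltA; exists (fset_set A).
set s := \sum_(w <- _) _.
(* [s] is the truncation of [x] to [A]. *)
have sE w : s w = if w \in A then x w else 0.
  rewrite ell2_sumE; case: ifPn => wA.
    rewrite (big_fsetD1 w) ?in_fset_set//= big1_seq.
      by rewrite addr0 [LHS](_ : _ = x w * (w == w)%:R)// eqxx mulr1.
    move=> v /andP[_]; rewrite !inE => /andP[vw _].
    by rewrite [LHS](_ : _ = x v * (w == v)%:R)// eq_sym (negbTE vw) mulr0.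
  rewrite big1_seq// => v /andP[_]; rewrite in_fset_set// => vA.
  rewrite [LHS](_ : _ = x v * (w == v)%:R)//.
  by case: eqVneq => [wv|]; [rewrite wv vA in wA|rewrite mulr0].
rewrite ell2_norm_le ?ltW//.
have -> : sqnorm_sum (x - s) = \esum_(w in ~` A) ((normc (x w)) ^+ 2)%:E.
  rewrite /sqnorm_sum [RHS]esum_mkcond; apply: eq_esum => w _.
  rewrite [X in normc X](_ : _ = x w - s w)// sE in_setC.
  by case: (w \in A); rewrite /= ?subr0// subrr normc0 expr0n.
move: ltA; rewrite lteBlDr// -/(esum _ _).
rewrite (esumID A); last by move=> w _; exact: normc_sq_ge0.
rewrite !setTI esum_fset//; last by move=> w _; exact: normc_sq_ge0.
rewrite fsbig_finite//= sumEFin lteD2lE//; exact: ltW.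
Qed.

(** By linearity, truncating [x] to a finite set gives a vector whose image vanishes at [v]. So
    [T x v] equals [T (x - s) v], which boundedness makes arbitrarily small. *)
Lemma bounded_eq0 (T : {linear H -> H}) x (v : I) : bounded_operator T ->
  (forall w, x w * T (xi w) v = 0) -> T x v = 0.
Proof.
move=> [M TM] Tv0; apply: eq0_normc; apply/eqP; rewrite eq_le normc_ge0 andbT.
(* The bound [M] may be zero or negative, so it is replaced by a positive one to divide by. *)
have M1_gt0 : 0 < `|M| + 1 by rewrite ltr_wpDl.
apply/ler_addgt0Pr => e e0; rewrite add0r.
have [A leA] := ell2_norm_tail x (divr_gt0 e0 M1_gt0).
set s := \sum_(w <- A) _ in leA.
have -> : T x v = T (x - s) v.
  have -> : T (x - s) v = T x v - T s v by rewrite linearB.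
  rewrite linear_sum ell2_sumE big1 ?subr0// => w _.
  by rewrite linearZ -[RHS](Tv0 w).
apply: (le_trans (normc_le_ell2_norm _ _)); apply: (le_trans (TM _)).
apply: (@le_trans _ _ ((`|M| + 1) * ell2_norm (x - s))).
  apply: ler_wpM2r; first exact: sqrtr_ge0.
  by rewrite (le_trans (ler_norm M))// lerDl.
by rewrite mulrC -ler_pdivlMr.
Qed.

End Ell2Norm.

(** * Identifying the adjoint *)

Section Adjoint.
Context {R : realType} {I : choiceType}.
Notation H := (ell2 R I).

Lemma ell2_inner_xi (u : I) (z : H) : ell2_inner (xi u) z = (z u)^*.
Proof.
rewrite /ell2_inner (sum_single (u := u)) => [|w /negbTE wu].
  by rewrite /= eqxx mul1r.
by rewrite /= wu mul0r.
Qed.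

(** The witness [z] rules out the default value of [xget]. Testing against the [xi w] recovers every
    coordinate, so the chosen vector is [z]. *)
Lemma adjointP (T : H -> H) (y z : H) :
  (forall x, ell2_inner (T x) y = ell2_inner x z) -> adjoint T y = z.
Proof.
move=> Tz; rewrite /adjoint; case: xgetP => [z' _ /= Tz'|/(_ z)//].
apply/val_inj/funext => w; apply: (can_inj (@conjCK _)).
by move: (Tz (xi w)); rewrite Tz' !ell2_inner_xi.
Qed.

End Adjoint.

(** * The adjoint of a weighted shift and its joint eigenvectors *)

Section WeightedShiftAdjoint.
Context {R : realType} {n : nat}.
Notation word := (seq 'I_n).
Notation fock := (ell2 R word).
Variables (Lambda : 'I_n -> word -> R) (T : 'I_n -> {linear fock -> fock}).
Hypotheses (Lambda_gt0 : forall i w, 0 < Lambda i w)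
           (hT : weighted_shift Lambda T).

Lemma shift_xiE i w v : T i (xi w) v = (Lambda i w)%:C * (v == i :: w)%:R.
Proof. by case: hT => _ ->. Qed.

Lemma shift_cons i (x : fock) w : T i x (i :: w) = (Lambda i w)%:C * x w.
Proof.
(* Removing the [w] component of [x] leaves only basis vectors whose images vanish at [i :: w]. *)
have /eqP : T i (x - x w *: xi w) (i :: w) = 0.
  apply: bounded_eq0; first by case: hT.
  move=> u; rewrite shift_xiE eqseq_cons eqxx/=.
  case: (eqVneq w u) => [<-|]; last by rewrite !mulr0.
  rewrite [X in X * _](_ : _ = x w - x w * (w == w)%:R)//.
  by rewrite eqxx mulr1 subrr mul0r.
rewrite linearB linearZ [X in X == 0](_ : _ =
  T i x (i :: w) - x w * T i (xi w) (i :: w))//.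
by rewrite subr_eq0 shift_xiE eqxx mulr1 mulrC => /eqP.
Qed.

Lemma shift_off_range i (x : fock) v : ~ range (cons i) v -> T i x v = 0.
Proof.
move=> iv; apply: bounded_eq0 => [|w]; first by case: hT.
rewrite shift_xiE; case: eqP => [vE|]; last by rewrite !mulr0.
by case: iv; exists w.
Qed.

(** Makes the candidate for the adjoint a vector of the space. Each weight is a coordinate of some
    [T i (xi w)], hence at most [|M|], and the sum is dominated by the part of the squared norm of
    [M%:C *: y] over words starting with [i]. *)
Lemma square_summable_shift_adjoint i (y : fock) :
  (fun w => (Lambda i w)%:C * y (i :: w) : R[i]^o) \in square_summable.
Proof.
have [M TM] := hT.1 i.
have LM w : Lambda i w <= `|M|.
  have := normc_le_ell2_norm (T i (xi w)) (i :: w).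
  rewrite shift_xiE eqxx mulr1 /normc/= expr0n addr0 sqrtr_sqr.
  rewrite (ger0_norm (ltW (Lambda_gt0 i w))) => /le_trans -> //.
  rewrite (le_trans (TM _))// (@le_trans _ _ (`|M| * ell2_norm (xi w : fock)))//.
    by rewrite ler_wpM2r ?sqrtr_ge0// ler_norm.
  by rewrite ler_piMr// ell2_norm_xi.
pose My : fock := M%:C *: y.
apply/asboolP; apply: (@le_lt_trans _ _ (sqnorm_sum My)); last first.
  by have /asboolP := ell2P My.
apply: (@le_trans _ _ (\esum_(v in range (cons i)) (normc (My v) ^+ 2)%:E)).
  rewrite esum_image; last by move=> u v _ _ [].
  apply: le_esum => w _; rewrite lee_fin.
  rewrite [X in _ <= normc X ^+ 2](_ : _ = M%:C * y (i :: w))// !normcM !exprMn.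
  rewrite ler_wpM2r ?sqr_ge0// /normc/= expr0n !addr0 !sqrtr_sqr.
  by rewrite lerXn2r ?nnegrE// (ger0_norm (ltW (Lambda_gt0 i w))).
rewrite /sqnorm_sum [leRHS](esumID (range (cons i))) ?setTI ?leeDl//.
  by apply: esum_ge0 => w _; exact: normc_sq_ge0.
by move=> w _; exact: normc_sq_ge0.
Qed.

Lemma shift_adjointE i (y : fock) w :
  adjoint (T i) y w = (Lambda i w)%:C * y (i :: w).
Proof.
rewrite (@adjointP _ _ _ _ (Ell2 (square_summable_shift_adjoint i y)))// => x.
(* The image of [T i] is supported on words starting with [i]; the weights are real, so conjugation
   fixes them. *)
rewrite /ell2_inner (@sum_reindex _ _ _ _ (cons i)).
- congr (summability.sum _); apply/funext => u /=.
  rewrite shift_cons rmorphM /= mulrA [_ * x u]mulrC.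
  by congr (_ * _ * _); exact: esym (conjc_real _).
- by move=> u v [].
- by move=> v iv; rewrite shift_off_range// mul0r.
Qed.

Lemma weight_gt0 w : 0 < weight Lambda [::] w.
Proof. by elim: w => //= i w IH; rewrite mulr_gt0. Qed.

(* The eigenvalue equations [Lambda i w * x (iw) = lam i * x w] determine [x]
   from its value at the empty word. *)
Lemma eigenvectorP (lam : 'rV[R[i]]_n) (x : fock) :
  (forall i, adjoint (T i) x = lam ord0 i *: x) <->
  (forall w, x w = word_eval lam w / (weight Lambda [::] w)%:C * x [::]).
Proof.
have L0 i w : (Lambda i w)%:C != 0 :> R[i].
  by rewrite (inj_eq (@complexI _)) gt_eqF.
have W0 w : (weight Lambda [::] w)%:C != 0 :> R[i].
  by rewrite (inj_eq (@complexI _)) gt_eqF ?weight_gt0.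
split=> [ev|xE i].
- elim=> [|i w IH]; first by rewrite /word_eval big_nil /= divr1 mul1r.
  have /(congr1 (fun z : fock => z w)) := ev i.
  rewrite shift_adjointE [RHS](_ : _ = lam ord0 i * x w)// IH => /(canRL (mulKf (L0 i w))) ->.
  rewrite /word_eval big_cons /= cats0 rmorphM /=.
  by field; rewrite L0 W0.
- apply/val_inj/funext => w; rewrite [LHS]shift_adjointE.
  rewrite [RHS](_ : _ = lam ord0 i * x w)// (xE w) (xE (i :: w)).
  rewrite /word_eval big_cons /= cats0 rmorphM /=.
  by field; rewrite L0 W0.
Qed.
End WeightedShiftAdjoint.

(** * Eigenvalues and convergence of the series *)

Theorem theorem4p3 (R : realType) (n : nat) (hn : (2 <= n)%N)
    (Lambda : 'I_n -> seq 'I_n -> R)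
    (Lambda_gt0 : forall i w, 0 < Lambda i w)
    (T : 'I_n -> {linear ell2 R (seq 'I_n) -> ell2 R (seq 'I_n)})
    (hT : weighted_shift Lambda T) :
  [set lam : 'rV[R[i]]_n | adjoint_eigenvalue T lam] =
  [set lam : 'rV[R[i]]_n |
    (\esum_(w in [set: seq 'I_n])
       (Normc.normc (word_eval lam w) ^+ 2 * weight Lambda [::] w ^- 2)%:E
     < +oo)%E].
Proof.
(* [f] is the only possible eigenvector with value 1 at the empty word; its squared moduli are the
   terms of the series. *)
apply/seteqP; split=> lam /=; pose f w : R[i]^o :=
  word_eval lam w / (weight Lambda [::] w)%:C.
all: have fE w : normc (f w) ^+ 2 =
    normc (word_eval lam w) ^+ 2 * weight Lambda [::] w ^- 2.
  1,3: rewrite normcM normcV exprMn -exprVn; congr (_ * _^-1 ^+ 2).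
  1,2: rewrite /normc/= expr0n addr0 sqrtr_sqr ger0_norm// ltW//.
  1,2: exact: weight_gt0.
all: under eq_esum => w _ do rewrite -fE.
- move=> [x x0 /(eigenvectorP Lambda_gt0 hT) xE].
  (* An eigenvector vanishing at the empty word would vanish everywhere, so [x] can be normalised to
     [f], which is then square summable. *)
  have xe0 : x [::] != 0.
    apply: contra_neq x0 => xe0; apply/val_inj/funext => w.
    by rewrite [LHS]xE xe0 mulr0.
  pose g : ell2 R _ := (x [::])^-1 *: x.
  have fg : f = g.
    apply/funext => w; apply: (canRL (mulKf xe0)).
    by rewrite [RHS]xE; exact: mulrC.
  rewrite -/(sqnorm_sum f) fg.
  exact: (asboolP _ (ell2P g)).
(* Convergence puts [f] itself in the space, and its value 1 at the empty word makes it nonzero. *)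
- move=> sf; have f_l2 : f \in square_summable by apply/asboolP.
  have fe : f [::] = 1 by rewrite /f /word_eval big_nil /= divr1.
  exists (Ell2 f_l2).
    apply/eqP => /(congr1 (fun z : ell2 R _ => z [::])) /=.
    by rewrite fe => /eqP; rewrite oner_eq0.
  by apply/(eigenvectorP Lambda_gt0 hT) => w /=; rewrite fe mulr1.
Qed.
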